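(* Let $A=(a_{ij})_{n\times n}$ be a real matrix with nonnegative entries, $L=\mathrm{diag}(A\mathbf 1)-A$, $\delta>0$, and let $\boldsymbol{v}=(v_1,\ldots,v_n)^{\mathrm T}$ be a vector with nonnegative entries, $s=\sum_{i=1}^n v_i$. Let $$L_0=\begin{pmatrix} L&\mathbf 0\\ \mathbf 0^{\mathrm T}&0\end{pmatrix},\qquad H_{\delta,\boldsymbol{v}}=\delta\begin{pmatrix} I&-\mathbf 1\\ \mathbf 0^{\mathrm T}&0\end{pmatrix}+\begin{pmatrix}0_{n\times n}&\mathbf 0\\ -\boldsymbol{v}^{\mathrm T}&s\end{pmatrix}.$$ If $\boldsymbol{y}(t)=(y_1(t),\ldots,y_{n+1}(t))^{\mathrm T}$ is a solution to the system $\dot{\boldsymbol{y}}(t)=-(L_0+H_{\delta,\boldsymbol{v}})\,\boldsymbol{y}(t)$, $t\ge0$ (the protocol with a hub that uniformly influences the agents), then $$\lim_{t\to\infty}\boldsymbol{y}(t)=\mathbf 1'\,\tfrac{1}{s+\delta}\Big[\boldsymbol{v}^{\mathrm T}\big(I+\tfrac1\delta L\big)^{-1}\;\;\delta\Big]\boldsymbol{y}(0).$$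
   Context: $\mathbf 1$ and $\mathbf 0$ are the all-ones and zero column vectors of length $n$, $\mathbf 1'$ is the all-ones column vector of length $n+1$, $I$ is the identity matrix of order $n$, and $\mathrm{diag}(\boldsymbol{u})$ is the diagonal matrix with the entries of $\boldsymbol{u}$ on the diagonal. $[\,\boldsymbol{u}^{\mathrm T}\;\;c\,]$ denotes the row vector of length $n+1$ obtained by appending $c$ to $\boldsymbol{u}^{\mathrm T}$. The $(n+1)$st agent is called the hub: it influences each of the $n$ agents with intensity $\delta$ and is influenced by agent $i$ with intensity $v_i$. *)

(* Defs.v *)
From mathcomp Require Import all_boot all_order all_algebra.
From mathcomp Require Import all_classical all_reals all_analysis.

Set Implicit Arguments.
Unset Strict Implicit.
Unset Printing Implicit Defensive.

Import Order.TTheory GRing.Theory Num.Theory.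
Import numFieldNormedType.Exports.

Local Open Scope classical_set_scope.
Local Open Scope ring_scope.

Definition laplacian (R : realType) (n : nat) (A : 'M[R]_n) : 'M[R]_n :=
  diag_mx (A *m (const_mx 1 : 'cV[R]_n))^T - A.

Definition hubL0 (R : realType) (n : nat) (A : 'M[R]_n) : 'M[R]_(n + 1) :=
  block_mx (laplacian A) 0
           0             0.

Definition hub_intensity (R : realType) (n : nat) (v : 'cV[R]_n) : R :=
  \sum_(i < n) v i 0.

Definition hubH (R : realType) (n : nat) (delta : R) (v : 'cV[R]_n) :
    'M[R]_(n + 1) :=
  delta *: block_mx 1%:M (- const_mx 1)
                    0    0
  + block_mx 0       0
             (- v^T) (hub_intensity v)%:M.

(* The time domain is [0, +oo[, so the derivative at 0 is one-sided;
   values y t with t < 0 are irrelevant. *)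
Definition linear_ode_solution (R : realType) (m : nat) (M : 'M[R]_m)
    (y : R -> 'cV[R]_m) : Prop :=
  (h^-1 *: (y h - y 0) @[h --> 0^'+] --> M *m y 0) /\
  (forall t : R, 0 < t -> is_derive t 1 y (M *m y t)).

(* Main.v *)
Require Import Defs.
From mathcomp Require Import all_boot all_order all_algebra.
From mathcomp Require Import all_classical all_reals all_analysis.
From mathcomp Require Import ring lra.

Set Implicit Arguments.
Unset Strict Implicit.
Unset Printing Implicit Defensive.

Import Order.TTheory GRing.Theory Num.Theory.
Import numFieldNormedType.Exports.

Local Open Scope classical_set_scope.
Local Open Scope ring_scope.

(** The matrix L0 + H is itself a Laplacian: that of the weighted digraph on
    n + 1 vertices in which every agent also listens to the hub with weight
    delta and the hub listens to agent i with weight v i ([hub_generatorE]).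
    The limit then follows from two facts about the flow of that Laplacian,
    and no spectral theory is involved.

    Contraction.  Let i and j be coordinates at which y is maximal and
    minimal at time t.  Every neighbour pulls y i down, and the hub alone does
    so at speed at least delta * (y i - y h); in the same way y j is pulled up
    at speed at least delta * (y h - y j).  Hence the spread y i - y j
    decreases at speed at least delta times itself, and it tends to 0
    ([spread_decay], [spread_cvg0]).  The maximum of finitely many
    differentiable functions need not be differentiable, so the argument is
    run through a maximum principle for finite families
    ([finite_family_max_principle]).

    Conservation.  If w is a row vector with w (L0 + H) = 0, then w y(t) is
    constant.  If moreover the entries of w sum to 1, then
    y i (t) = w y(0) + \sum_j w j (y i (t) - y j (t)), and the sum vanishes in
    the limit ([consensus_limit]).

    The weights in the theorem form such a w.  With P = I + L / delta, the
    identity L + delta I = delta P gives w (L0 + H) = 0, and P 1 = 1 gives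
    v^T P^-1 1 = s, hence total weight 1.  The matrix P is invertible by the
    discrete maximum principle for L ([laplacian_resolvent_unit]). *)

(** * A maximum principle for finite families of functions *)

(** Only the left difference quotients are controlled, because in the maximum
    principle below the maximum over [0, T] may be reached at T. *)
Lemma is_derive_ge0_at_left_max (R : realType) (f : R -> R) (c d : R) :
  0 < c -> is_derive c 1 f d ->
  (forall t, 0 <= t -> t <= c -> f t <= f c) -> 0 <= d.
Proof.
move=> c_gt0 [dfc <-] fmax; rewrite ['D_1 f c]cvg_at_leftE; last exact: dfc.
apply: limr_ge.
  rewrite -(cvg_at_leftE (fun h => h^-1 *: ((f \o shift c) _ - f c))) //.
  apply: cvg_trans dfc; apply: cvg_app.
  move=> P [e e_gt0 Pe]; exists e => // x xe x_lt0; apply: Pe => //.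
  exact/ltr0_neq0.
near=> h.
have h_lt0 : h < 0 by near: h; exact: nbhs_left_lt.
have ch : - c < h by near: h; apply: nbhs_left_gt; rewrite oppr_lt0.
apply: mulr_le0; first by rewrite invr_le0 ltW.
rewrite subr_le0 [_%:A]mulr1 /=; apply: fmax; lra.
Unshelve. all: by end_near. Qed.

(** Take the largest value reached by any member of the family on [0, T].  If
    it exceeds C, it is reached at a positive time, by a function which is
    then maximal in the family and has a nonnegative derivative there. *)
Lemma finite_family_max_principle (R : realType) (I : finType)
    (f df : I -> R -> R) (C : R) :
  (forall k (T : R), 0 < T -> {within `[0, T], continuous (f k)}) ->
  (forall k (t : R), 0 < t -> is_derive t 1 (f k) (df k t)) ->
  (forall k, f k 0 <= C) ->
  (forall k (t : R), 0 < t -> C < f k t -> (forall l, f l t <= f k t) ->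
     df k t < 0) ->
  forall k t, 0 <= t -> f k t <= C.
Proof.
move=> fcont fder f0 dfneg k0 T; rewrite le_eqVlt => /predU1P[<-//|T_gt0].
rewrite leNgt; apply/negP => CfT.
have /choice[c cP] k : exists c, (c \in `[0, T]%R) /\
    forall t, t \in `[0, T]%R -> f k t <= f k c.
  by have [c] := EVT_max (ltW T_gt0) (fcont k T T_gt0); exists c.
have [k _ kmax] := Order.TotalTheory.arg_maxP (fun k => f k (c k))
  (isT : xpredT k0).
have maxk l t : t \in `[0, T]%R -> f l t <= f k (c k).
  by move=> tT; apply: le_trans (kmax l isT); apply: (cP l).2.
have TT : T \in `[0, T]%R by rewrite in_itv /= lexx ltW.
have Cf : C < f k (c k) by exact: lt_le_trans CfT (maxk k0 T TT).
have /andP[ck_ge0 ckT] : 0 <= c k <= T by have := (cP k).1; rewrite in_itv.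
have ck_gt0 : 0 < c k.
  rewrite lt_neqAle ck_ge0 andbT; apply/eqP => ck0.
  by move: Cf; rewrite -ck0 ltNge f0.
have := dfneg k (c k) ck_gt0 Cf (fun l => maxk l _ (cP k).1).
rewrite ltNge; apply/negP; rewrite negbK.
apply: is_derive_ge0_at_left_max ck_gt0 (fder k _ ck_gt0) _ => t t_ge0 tc.
by apply: maxk; rewrite in_itv /= t_ge0 (le_trans tc).
Qed.

(** * Linear systems of differential equations *)

Section LinearOde.
Variables (R : realType) (m : nat) (M : 'M[R]_m) (y : R -> 'cV[R]_m).
Hypothesis y_sol : linear_ode_solution M y.

Lemma solution_is_derive_coord i (t : R) : 0 < t ->
  is_derive t 1 (fun s => y s i 0) ((M *m y t) i 0).
Proof.
move=> /y_sol.2[dy <-]; have /derivable_mxP dyi := dy.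
by apply: DeriveDef; [exact: dyi | rewrite derive_mx // mxE].
Qed.

(** Right continuity at 0 is recovered from the one-sided derivative, as
    y h = h * ((y h - y 0) / h) + y 0. *)
Lemma solution_cvg_at_right0 : y h @[h --> 0^'+] --> y 0.
Proof.
have idc : h @[h --> 0^'+] --> (0 : R) by exact: cvg_at_right_filter.
have Dy : h *: (h^-1 *: (y h - y 0)) + y 0 @[h --> 0^'+] --> y 0.
  rewrite -[X in _ --> X]add0r -[X in X + _](scale0r (M *m y 0)).
  by apply: cvgD (cvg_cst _); apply: cvgZ idc y_sol.1.
apply: (cvg_trans _ Dy); apply: near_eq_cvg; near=> h.
have h0 : h != 0 by rewrite gt_eqF //; near: h; exact: nbhs_right_gt.
by rewrite /= scalerA divff // scale1r subrK.
Unshelve. all: by end_near. Qed.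

Lemma solution_coord_continuous i (T : R) : 0 < T ->
  {within `[0, T], continuous (fun s => y s i 0)}.
Proof.
move=> T_gt0.
have cont t : 0 < t -> {for t, continuous (fun s => y s i 0)}.
  move=> t_gt0; apply/differentiable_continuous/derivable1_diffP.
  by have [] := solution_is_derive_coord i t_gt0.
apply/continuous_within_itvP => //; split.
- by move=> t; rewrite in_itv /= => /andP[t_gt0 _]; exact: cont.
- exact: (cvg_comp _ _ solution_cvg_at_right0 (@coord_continuous _ _ _ i 0 _)).
- exact: cvg_at_left_filter (cont T T_gt0).
Qed.

Lemma left_null_conserved (w : 'rV[R]_m) (t : R) : w *m M = 0 -> 0 <= t ->
  w *m y t = w *m y 0.
Proof.
move=> wM t_ge0; pose g s := \sum_j w 0 j *: y s j 0.
suff gE : g t = g 0.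
  apply/matrixP => a b; rewrite !ord1 !mxE; exact: gE.
have gder s : s \in `]0, t[%R -> is_derive s 1 g 0.
  rewrite in_itv /= => /andP[s_gt0 _].
  have dyj j := solution_is_derive_coord j s_gt0.
  have -> : g = \sum_j (w 0 j \*: (fun s => y s j 0)).
    by apply/funext => r; rewrite fct_sumE.
  apply: is_derive_eq.
  have := congr1 (fun N => (N *m y s) 0 0) wM.
  by rewrite -mulmxA mul0mx [LHS]mxE [RHS]mxE.
have [|c _] := MVT_segment t_ge0 gder; last by rewrite mul0r => /subr0_eq.
move: t_ge0; rewrite le_eqVlt => /predU1P[<-|t_gt0].
  by rewrite set_itv1; exact: continuous_subspace1.
move=> s; apply: cvg_big => [|j _]; first exact: add_continuous.
apply: cvgZr.
exact: solution_coord_continuous.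
Qed.

End LinearOde.

(** * Laplacians of weighted digraphs *)

Lemma laplacianE (R : realType) (m : nat) (B : 'M[R]_m) (x : 'cV[R]_m) i :
  (laplacian B *m x) i 0 = \sum_j B i j * (x i 0 - x j 0).
Proof.
rewrite /laplacian mulmxBl mul_diag_mx !mxE mulr_suml -sumrB.
by apply: eq_bigr => j _; rewrite mxE mulr1 mulrBr.
Qed.

Lemma laplacian_const (R : realType) (m : nat) (B : 'M[R]_m) :
  laplacian B *m (const_mx 1 : 'cV_m) = 0.
Proof.
apply/colP => i; rewrite laplacianE [RHS]mxE big1 // => j _.
by rewrite !mxE subrr mulr0.
Qed.

Lemma laplacian_ge0_at_max (R : realType) (m : nat) (B : 'M[R]_m)
    (x : 'cV[R]_m) i :
  (forall i j, 0 <= B i j) -> (forall j, x j 0 <= x i 0) ->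
  0 <= (laplacian B *m x) i 0.
Proof.
move=> B_ge0 xmax; rewrite laplacianE sumr_ge0 // => j _.
by rewrite mulr_ge0 // subr_ge0.
Qed.

(** Where x is maximal the Laplacian is nonnegative, so x = - c L x is
    nonpositive there, hence everywhere. *)
Lemma laplacian_resolvent_le0 (R : realType) (m : nat) (B : 'M[R]_m) (c : R)
    (x : 'cV[R]_m) :
  (forall i j, 0 <= B i j) -> 0 <= c ->
  (1%:M + c *: laplacian B) *m x = 0 -> forall j, x j 0 <= 0.
Proof.
move=> B_ge0 c_ge0 xker j.
have [i _ xmax] := Order.TotalTheory.arg_maxP (fun k => x k 0)
  (isT : xpredT j).
apply: le_trans (xmax j isT) _.
have := congr1 (fun N : 'cV_m => N i 0) xker.
rewrite mulmxDl mul1mx -scalemxAl mxE [X in _ + X]mxE [RHS]mxE => /eqP.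
rewrite addr_eq0 => /eqP ->; rewrite oppr_le0 mulr_ge0 //.
by apply: laplacian_ge0_at_max => // k; exact: xmax.
Qed.

(** The previous bound, applied to x and to - x, leaves only 0 in the
    kernel. *)
Lemma laplacian_resolvent_unit (R : realType) (m : nat) (B : 'M[R]_m) (c : R) :
  (forall i j, 0 <= B i j) -> 0 <= c ->
  1%:M + c *: laplacian B \in unitmx.
Proof.
move=> B_ge0 c_ge0; rewrite -unitmx_tr -row_free_unit.
apply: inj_row_free => u uker.
have xker : (1%:M + c *: laplacian B) *m u^T = 0.
  by apply: trmx_inj; rewrite trmx_mul trmxK uker trmx0.
apply/rowP => j; apply/eqP; rewrite [X in _ == X]mxE eq_le; apply/andP; split.
  by have := laplacian_resolvent_le0 B_ge0 c_ge0 xker j; rewrite mxE.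
have Nxker : (1%:M + c *: laplacian B) *m (- u^T) = 0 by rewrite mulmxN xker oppr0.
have := laplacian_resolvent_le0 B_ge0 c_ge0 Nxker j.
by rewrite !mxE oppr_le0.
Qed.

(** * Consensus in the presence of a hub *)

Section Consensus.
Variables (R : realType) (m : nat) (B : 'M[R]_m) (h : 'I_m) (delta : R).
Variable y : R -> 'cV[R]_m.
Hypothesis B_ge0 : forall i j, 0 <= B i j.
Hypothesis delta_gt0 : 0 < delta.
Hypothesis hub : forall i, i != h -> delta <= B i h.
Hypothesis y_sol : linear_ode_solution (- laplacian B) y.

(** At a maximum all the terms B i j * (x i - x j) are nonnegative, and the
    one that comes from the hub is bounded below by hypothesis. *)
Lemma laplacian_ge_at_max (x : 'cV[R]_m) i :
  (forall j, x j 0 <= x i 0) ->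
  delta * (x i 0 - x h 0) <= (laplacian B *m x) i 0.
Proof.
move=> xmax; rewrite laplacianE (bigD1 h) //=.
rewrite -[leLHS]addr0 lerD ?sumr_ge0 //; last first.
  by move=> j _; rewrite mulr_ge0 // subr_ge0.
have [->|ih] := eqVneq i h; first by rewrite subrr !mulr0.
by rewrite ler_wpM2r ?subr_ge0 // hub.
Qed.

(** The hub value cancels between the bound at the maximum i of x and the
    bound at the maximum j of - x. *)
Lemma laplacian_spread (x : 'cV[R]_m) i j :
  (forall k l, x k 0 - x l 0 <= x i 0 - x j 0) ->
  delta * (x i 0 - x j 0) <= (laplacian B *m x) i 0 - (laplacian B *m x) j 0.
Proof.
move=> xmax.
have xi k : x k 0 <= x i 0 by have := xmax k j; lra.
have xj k : (- x) k 0 <= (- x) j 0 by rewrite !mxE; have := xmax i k; lra.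
have := laplacian_ge_at_max xi; have := laplacian_ge_at_max xj.
by rewrite mulmxN !mxE; lra.
Qed.

(** The spread D satisfies D' <= - delta D in a weak sense, which gives
    exponential decay.  The factor 1 + delta t, which grows more slowly than
    exp (delta t), is enough to force D to 0, and it makes the derivative of
    the product at most - delta^2 t D, strictly negative when t > 0 and D > 0,
    as the maximum principle requires. *)
Lemma spread_decay (C : R) : (forall i j, y 0 i 0 - y 0 j 0 <= C) ->
  forall i j (t : R), 0 <= t -> (1 + delta * t) * (y t i 0 - y t j 0) <= C.
Proof.
move=> y0C i j t t_ge0.
have C_ge0 : 0 <= C by rewrite (le_trans _ (y0C i i)) // subrr.
pose f (k : 'I_m * 'I_m) (s : R) := (1 + delta * s) * (y s k.1 0 - y s k.2 0).
pose df (k : 'I_m * 'I_m) (s : R) := delta * (y s k.1 0 - y s k.2 0) -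
  (1 + delta * s) * ((laplacian B *m y s) k.1 0 - (laplacian B *m y s) k.2 0).
apply: (@finite_family_max_principle _ _ f df C _ _ _ _ (i, j)) t_ge0
  => {i j t} [k T T_gt0|k s s_gt0|[k l]|[i j] s s_gt0 Cf fmax].
- move=> s; apply: cvgM.
    apply: cvgD; first exact: cvg_cst.
    by apply: cvgM; [exact: cvg_cst | apply: continuous_subspaceT => r; exact: cvg_id].
  by apply: cvgB; exact: (solution_coord_continuous y_sol).
- have d1 := solution_is_derive_coord y_sol k.1 s_gt0.
  have d2 := solution_is_derive_coord y_sol k.2 s_gt0.
  have -> : f k = (cst 1 + (delta \*: id)) *
      ((fun s => y s k.1 0) - (fun s => y s k.2 0)) by [].
  apply: is_derive_eq.
  rewrite /df mulNmx ![(- (_ *m _)) _ _]mxE /GRing.scale /=.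
  (* Both conversions only evaluate pointwise sums of functions. *)
  rewrite -[(cst 1 + _) s]/(1 + delta * s).
  rewrite -[(_ - (fun r => y r k.2 0)) s]/(y s k.1 0 - y s k.2 0); ring.
- by rewrite /f mulr0 addr0 mul1r.
have ds_gt0 : 0 < 1 + delta * s by rewrite addr_gt0 // mulr_gt0.
have D_gt0 : 0 < y s i 0 - y s j 0.
  by rewrite -(pmulr_rgt0 _ ds_gt0) (le_lt_trans C_ge0).
have /laplacian_spread L_ge k l : y s k 0 - y s l 0 <= y s i 0 - y s j 0.
  by have := fmax (k, l); rewrite /f /= ler_pM2l.
rewrite /df /= subr_lt0; apply: (@lt_le_trans _ _
  ((1 + delta * s) * (delta * (y s i 0 - y s j 0)))); last first.
  by rewrite ler_wpM2l // ltW.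
by rewrite mulrDl mul1r ltrDl !mulr_gt0.
Qed.

Lemma spread_cvg0 i j : y t i 0 - y t j 0 @[t --> +oo] --> 0.
Proof.
(* Any bound on the initial spread will do. *)
pose C := \sum_k \sum_l `|y 0 k 0 - y 0 l 0|.
have y0C k l : y 0 k 0 - y 0 l 0 <= C.
  rewrite (le_trans (ler_norm _)) // /C (bigD1 k) //= (bigD1 l) //= -addrA.
  by rewrite lerDl addr_ge0 ?sumr_ge0 // => ? _; rewrite sumr_ge0.
have C_ge0 : 0 <= C by rewrite (le_trans _ (y0C i i)) // subrr.
apply/cvgrPdist_le => e e_gt0; near=> t.
have t_ge0 : 0 <= t by near: t; exact: nbhs_pinfty_ge.
have tC : C / (e * delta) <= t by near: t; apply: nbhs_pinfty_ge; exact: num_real.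
have ds_gt0 : 0 < 1 + delta * t by rewrite ltr_wpDr // mulr_ge0 // ltW.
have Ce : C <= (1 + delta * t) * e.
  move: tC; rewrite ler_pdivrMr ?mulr_gt0 //; nra.
rewrite sub0r normrN ler_norml; apply/andP; split.
  rewrite lerNl opprB -(ler_pM2l ds_gt0).
  exact: le_trans (spread_decay y0C j i t_ge0) Ce.
rewrite -(ler_pM2l ds_gt0).
exact: le_trans (spread_decay y0C i j t_ge0) Ce.
Unshelve. all: by end_near. Qed.

(** Every coordinate differs from the conserved average w y(0) by a fixed
    linear combination of spreads. *)
Lemma consensus_limit (w : 'rV[R]_m) :
  w *m laplacian B = 0 -> w *m (const_mx 1 : 'cV_m) = 1%:M ->
  y t @[t --> +oo] --> (const_mx 1 : 'cV_m) *m w *m y 0.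
Proof.
move=> wB w1; rewrite -mulmxA.
have w1' : \sum_j w 0 j = 1.
  have := congr1 (fun N : 'M[R]_1 => N 0 0) w1; rewrite !mxE /= mulr1n => <-.
  by apply: eq_bigr => j _; rewrite mxE mulr1.
have wM : w *m - laplacian B = 0 by rewrite mulmxN wB oppr0.
have yE t i : 0 <= t ->
    y t i 0 = (w *m y 0) 0 0 + \sum_j w 0 j * (y t i 0 - y t j 0).
  move=> t_ge0; rewrite -(left_null_conserved y_sol wM t_ge0) mxE -big_split /=.
  rewrite -[LHS]mul1r -w1' mulr_suml; apply: eq_bigr => j _.
  by rewrite -mulrDr addrC subrK.
have coord i : y t i 0 @[t --> +oo] --> (w *m y 0) 0 0.
  have S0 : (w *m y 0) 0 0 + \sum_j w 0 j * (y t i 0 - y t j 0) @[t --> +oo]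
      --> (w *m y 0) 0 0 + \sum_(j < m) w 0 j * 0.
    apply: cvgD; first exact: cvg_cst.
    apply: cvg_big => [|j _]; first exact: add_continuous.
    by apply: cvgM; [exact: cvg_cst | exact: spread_cvg0].
  rewrite [X in _ --> X](_ : _ = (w *m y 0) 0 0 + \sum_(j < m) w 0 j * 0).
    apply: cvg_trans S0; apply: near_eq_cvg; near=> t.
    by rewrite -yE //; near: t; exact: nbhs_pinfty_ge.
  by rewrite big1 ?addr0 // => j _; rewrite mulr0.
apply/cvgrPdist_le => e e_gt0; near=> t.
rewrite /Num.Def.normr /= mx_normrE (bigmax_le _ (ltW e_gt0)) //= => -[i k] _.
rewrite ord1 !mxE big_ord1 mxE mul1r; move: (i); near: t.
apply: filter_forall => {}i; exact: ((cvgrPdist_le _ _).1 (coord i)).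
Unshelve. all: by end_near. Qed.

End Consensus.

(** * The protocol with a hub *)

(** Influence weights among the agents and the hub, which is the last
    vertex: row i lists the weights with which i is influenced. *)
Definition hub_weights (R : realType) (n : nat) (A : 'M[R]_n) (delta : R)
    (v : 'cV[R]_n) : 'M[R]_(n + 1) :=
  block_mx A (const_mx delta) v^T 0.

Lemma hub_generatorE (R : realType) (n : nat) (A : 'M[R]_n) (delta : R)
    (v : 'cV[R]_n) :
  hubL0 A + hubH delta v = laplacian (hub_weights A delta v).
Proof.
rewrite /laplacian /hub_weights /hubL0 /hubH -col_mx_const mul_block_col.
rewrite tr_col_mx diag_mx_row opp_block_mx add_block_mx scale_block_mx.
rewrite !add_block_mx; congr block_mx.
- rewrite scalemx1 addr0 /laplacian addrAC linearD /= linearD /=; congr (_ + _ - _).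
  by apply/matrixP => i j; rewrite !mxE big_ord1 !mxE mulr1.
- by rewrite !(add0r, addr0); apply/matrixP => i j; rewrite !mxE mulrN mulr1.
- by rewrite !(scaler0, add0r).
rewrite !(scaler0, add0r, mul0mx, subr0, addr0, oppr0).
apply/matrixP => i j; rewrite !ord1 !mxE /= /hub_intensity; congr (_ *+ _).
by apply: eq_bigr => k _; rewrite !mxE mulr1.
Qed.

(** Since L annihilates the all-ones vector, I + c L fixes it, and so does the
    inverse. *)
Lemma resolvent_row_sum (R : realType) (n : nat) (A : 'M[R]_n) (c : R)
    (v : 'cV[R]_n) :
  1%:M + c *: laplacian A \in unitmx ->
  v^T *m invmx (1%:M + c *: laplacian A) *m (const_mx 1 : 'cV_n) =
    (hub_intensity v)%:M.
Proof.
set P := 1%:M + _ => Pu.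
have P1 : P *m (const_mx 1 : 'cV_n) = const_mx 1.
  by rewrite mulmxDl mul1mx -scalemxAl laplacian_const scaler0 addr0.
rewrite -mulmxA -{1}P1 mulKmx //.
apply/matrixP => i j; rewrite !ord1 !mxE /hub_intensity mulr1n.
by apply: eq_bigr => k _; rewrite !mxE mulr1.
Qed.

Lemma hub_left_null (R : realType) (n : nat) (A : 'M[R]_n) (delta : R)
    (v : 'cV[R]_n) :
  delta != 0 -> 1%:M + delta^-1 *: laplacian A \in unitmx ->
  row_mx (v^T *m invmx (1%:M + delta^-1 *: laplacian A)) delta%:M *m
    (hubL0 A + hubH delta v) = 0.
Proof.
move=> d0 Pu; have v1 := resolvent_row_sum v Pu.
move: Pu v1; set P := 1%:M + _ => Pu v1.
have LP : laplacian A + delta *: 1%:M = delta *: P.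
  by rewrite scalerDr scalerA divff // scale1r addrC.
rewrite /hubL0 /hubH scale_block_mx !add_block_mx mul_row_block.
rewrite !(scaler0, add0r, addr0) LP -row_mx0; congr row_mx.
  by rewrite -scalemxAr -mulmxA mulVmx // mulmx1 mul_scalar_mx scalerN subrr.
by rewrite -scalemxAr mulmxN v1 mul_scalar_mx scalerN addrC subrr.
Qed.

Theorem theorem3p2 (R : realType) (n : nat) (A : 'M[R]_n) (delta : R)
    (v : 'cV[R]_n) (y : R -> 'cV[R]_(n + 1))
    (A_ge0 : forall i j, 0 <= A i j)
    (delta_gt0 : 0 < delta)
    (v_ge0 : forall i, 0 <= v i 0)
    (y_sol : linear_ode_solution (- (hubL0 A + hubH delta v)) y) :
  y t @[t --> +oo] -->
    (const_mx 1 : 'cV[R]_(n + 1)) *m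
    ((hub_intensity v + delta)^-1 *:
       row_mx (v^T *m invmx (1%:M + delta^-1 *: laplacian A)) delta%:M) *m
    y 0.
Proof.
have Pu : 1%:M + delta^-1 *: laplacian A \in unitmx.
  by apply: laplacian_resolvent_unit => //; rewrite invr_ge0 ltW.
have sd_gt0 : 0 < hub_intensity v + delta.
  by rewrite ltr_wpDl // sumr_ge0.
have y_sol' := y_sol; rewrite hub_generatorE in y_sol'.
apply: (consensus_limit (h := rshift n ord0) _ delta_gt0 _ y_sol').
- move=> i j; rewrite /hub_weights.
  by case: (split_ordP i) => i' ->; case: (split_ordP j) => j' ->;
    rewrite ?(block_mxEul, block_mxEur, block_mxEdl, block_mxEdr) ?mxE ?ord1 //
      ltW.
- move=> i; case: (split_ordP i) => i' -> => [_|]; last by rewrite ord1 eqxx.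
  by rewrite block_mxEur mxE.
- by rewrite -hub_generatorE -scalemxAl hub_left_null ?scaler0 // gt_eqF.
rewrite -scalemxAl -col_mx_const mul_row_col resolvent_row_sum //.
rewrite mul_scalar_mx; apply/matrixP => i j.
by rewrite !ord1 !mxE !mulr1n mulr1 mulVf ?gt_eqF.
Qed.
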